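(* Let $q$ be a power of an odd prime such that $\sqrt{-1}\in\mathbb{F}_q$, let $1\le k\le n$, and let $j,m\ge 0$ be integers. The number $|\mathrm{Gr}(k,n)_{\mathbb{F}_q}|$ of $\mathbb{F}_q$-points of $\mathrm{Gr}(k,n)$ is given as follows. (i) If $(k,n)$ equals $(2j,2m)$, $(2j,2m+1)$ or $(2j+1,2m+1)$, then $$|\mathrm{Gr}(k,n)_{\mathbb{F}_q}|=q^r\begin{bmatrix}m\\ j\end{bmatrix}_{q^2}\quad\text{with } r=k(n-k)-2j(m-j).$$ (ii) If $(k,n)=(2j+1,2m)$, then $$|\mathrm{Gr}(k,n)_{\mathbb{F}_q}|=q^r\begin{bmatrix}m-1\\ j\end{bmatrix}_{q^2}(q^m-1)\quad\text{with } r=k(n-k)-2j(m-j-1)-m.$$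
   Context: $\begin{bmatrix}m\\ j\end{bmatrix}_{x}=\frac{[m]_x!}{[j]_x!\,[m-j]_x!}$ is the Gaussian binomial coefficient, where $[i]_x=(1-x^i)/(1-x)$ and $[i]_x!=[i]_x\cdots[1]_x$. $\mathrm{Gr}(k,n)_{\overline{\mathbb{F}}_q}$ denotes the analogue over $\overline{\mathbb{F}}_q$ of the complexification $\mathrm{Gr}(k,n)_{\mathbb{C}}=\mathrm{SO}_n(\mathbb{C})\cdot V_{\mathbb{C}}\subset \mathrm{Gr}(k,n,\mathbb{C})$ of the real Grassmannian, where $V_{\mathbb C}$ is the complexification of a real $k$-dimensional subspace of $\mathbb{R}^n$. Namely, $\mathrm{Gr}(k,n)_{\overline{\mathbb{F}}_q}$ is the Zariski open subset of the Grassmannian $\mathrm{Gr}(k,n,\overline{\mathbb{F}}_q)$ of $k$-dimensional subspaces of $\overline{\mathbb{F}}_q^{\,n}$ given by the $\mathrm{SO}_n(\overline{\mathbb{F}}_q)$-orbit of the span of the first $k$ standard basis vectors, where $\mathrm{SO}_n$ is the special orthogonal group of the form $x_1^2+\cdots+x_n^2$ (equivalently, the subspaces on which the restriction of this form is nondegenerate). $\mathrm{Gr}(k,n)_{\mathbb{F}_q}$ is its set of $\mathbb{F}_q$-points, i.e. the subspaces in it that are defined over $\mathbb{F}_q$. *)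

(* Defs.v *)
From mathcomp Require Import all_boot all_order all_algebra all_field.
From mathcomp Require Import finmap boolp classical_sets cardinality.

Set Implicit Arguments.
Unset Strict Implicit.
Unset Printing Implicit Defensive.

Import GRing.Theory.
Local Open Scope classical_set_scope.
Local Open Scope ring_scope.

Section QAnalogues.
Variable R : fieldType.
Implicit Type x : R.

(* The quotient is meaningful for x != 1 (in characteristic 0 and with x > 1,
   as in the evaluation at x = q ^ 2, all factors are nonzero). *)
Definition qint x (i : nat) : R := (1 - x ^+ i) / (1 - x).

Definition qfact x (i : nat) : R := \prod_(1 <= l < i.+1) qint x l.

(* Intended for j <= m, since m - j is truncated. *)
Definition qbinom x (m j : nat) : R := qfact x m / (qfact x j * qfact x (m - j)).

End QAnalogues.

Section Grassmannian.
Variable K : fieldType.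

Definition sumsq n (v : 'cV[K]_n) : K := \sum_(i < n) v i 0 ^+ 2.

Definition SOn n : set 'M[K]_n :=
  [set g | (forall v : 'cV[K]_n, sumsq (g *m v) = sumsq v) /\ \det g = 1].
Arguments SOn n _ : clear implicits.

Definition std_subspace (k n : nat) : {vspace 'cV[K]_n} :=
  <<[seq delta_mx i 0%R | i : 'I_n <- enum 'I_n & (i < k)%N]>>%VS.

Definition Gr (k n : nat) : set {vspace 'cV[K]_n} :=
  [set (linfun (mulmx g) @: std_subspace k n)%VS | g in SOn n].
Arguments Gr k n _ : clear implicits.

End Grassmannian.

Arguments SOn {K} n _.
Arguments std_subspace {K} k n.
Arguments Gr {K} k n _.

Section RationalPoints.
Variables (F K : fieldType) (iota : {rmorphism F -> K}).

Definition defined_over n (U : {vspace 'cV[K]_n}) : Prop :=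
  exists X : seq 'cV[F]_n, U = <<[seq map_mx iota v | v <- X]>>%VS.

Definition Gr_points (k n : nat) : set {vspace 'cV[K]_n} :=
  [set U | Gr k n U /\ defined_over U].

End RationalPoints.

Arguments Gr_points {F K} iota k n _.

Definition is_algebraic_closure (F : fieldType) (K : closedFieldType)
    (iota : {rmorphism F -> K}) : Prop :=
  forall x : K, algebraicOver iota x.

(* Main.v *)
Require Import Defs.
From mathcomp Require Import all_boot all_order all_algebra all_field.
From mathcomp Require Import fingroup cyclic.
From mathcomp Require Import finmap boolp classical_sets cardinality.
From mathcomp Require Import ring zify.

Set Implicit Arguments.
Unset Strict Implicit.
Unset Printing Implicit Defensive.

Import Order.TTheory GRing.Theory Num.Theory.
Local Open Scope ring_scope.

(** A subspace [U] of [K^n] defined over [F] is the scalar extension of a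
subspace [W] of [F^n], and [U] lies in the [SO_n]-orbit of the coordinate
subspace exactly when the sum of squares is nondegenerate on [W]
([Gr_points_nondeg]).  A Gram matrix of [W] is invertible over [F] iff it is
so over [K]; and over [K], where square roots exist, a nondegenerate subspace
has an orthonormal basis, which reflections extend to a matrix of [SO_n]
([special_orthonormal_extension]).  So the task is to count the nondegenerate
[k]-dimensional subspaces of the quadratic space [F^n].

Over [F] a nondegenerate form of given dimension is congruent to
[diag(1, ..., 1, t)], where [t] is 1 or a fixed nonsquare [nu]
([congruent_std_form]), and the two classes are told apart by the determinant
modulo squares.  The subspaces of one class are counted by their bases having
that Gram matrix, called frames here, each subspace having as many of them as
its form has automorphisms ([card_frame_spaces]).  Frames are built one vector
at a time.  Since reflections act transitively on the vectors of norm 1, the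
orthogonal complement of such a vector is always the standard space with one
coordinate less, so the number of frames is a product of sizes of spheres
([card_frames_dsum1]).

Sphere sizes follow from [x^2 + y^2 = (x + iy)(x - iy)], where [i^2 = -1]:
splitting off this hyperbolic plane lowers the dimension by two
([sphere_hyperbolic]), which leaves dimensions one and two to be treated by
hand.  Altogether the count is
[|O(n)| / (|O(k)| |O(n-k)|) + |O(n)| / (|O'(k)| |O'(n-k)|)],
where primes mark the form with [t = nu] and the second summand is absent for
[k = n] ([card_nondeg_spaces]).  The orders are powers of [q] times products of the [q^(2h) - 1], with an extra
factor [q^a - 1] or [q^a + 1] in even dimension [2a], according to the class.
Adding the two summands merges these extra factors, through
[(q^a + 1)(q^b + 1) + (q^a - 1)(q^b - 1) = 2 (q^(a+b) + 1)] when all the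
dimensions are even, and leaves the binomial coefficient in [q^2]. *)

(** * Reflections *)

Definition bilin (R : fieldType) n (B : 'M[R]_n) (x y : 'rV[R]_n) : R :=
  (x *m B *m y^T) 0 0.

Section Reflections.
Variables (R : fieldType) (n : nat) (B : 'M[R]_n).
Hypotheses (two_neq0 : 2 != 0 :> R) (symB : B^T = B).
Implicit Types x y z w : 'rV[R]_n.

Lemma bilinE x y : x *m B *m y^T = (bilin B x y)%:M.
Proof. exact: mx11_scalar. Qed.

Lemma bilinC x y : bilin B x y = bilin B y x.
Proof.
have := congr1 (fun M : 'M_1 => M 0 0) (trmx_mul (x *m B) y^T).
by rewrite mxE trmxK trmx_mul symB mulmxA.
Qed.

Lemma bilinBr x y z : bilin B x (y - z) = bilin B x y - bilin B x z.
Proof.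
by rewrite /bilin linearB mulmxBr; set u := _ *m _; set v := _ *m _; rewrite !mxE.
Qed.

Lemma bilinDr x y z : bilin B x (y + z) = bilin B x y + bilin B x z.
Proof.
by rewrite /bilin linearD mulmxDr; set u := _ *m _; set v := _ *m _; rewrite mxE.
Qed.

Lemma bilin_sqrB x y :
  bilin B (x - y) (x - y) = bilin B x x - 2 * bilin B x y + bilin B y y.
Proof. by rewrite bilinBr !(bilinC (x - y)) !bilinBr (bilinC y x); ring. Qed.

Lemma bilin_sqrD x y :
  bilin B (x + y) (x + y) = bilin B x x + 2 * bilin B x y + bilin B y y.
Proof. by rewrite bilinDr !(bilinC (x + y)) !bilinDr (bilinC y x); ring. Qed.

(** Polarization: in characteristic other than 2 the values [bilin B u u]
determine all of [B]. *)
Lemma bilin_diag_eq0 : (forall u, bilin B u u = 0) -> B = 0.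
Proof.
move=> B0; apply/matrixP => k l; rewrite [RHS]mxE.
have -> : B k l = bilin B (delta_mx 0 k) (delta_mx 0 l).
  by rewrite /bilin -rowE trmx_delta -colE !mxE.
have := B0 (delta_mx 0 k + delta_mx 0 l).
rewrite bilin_sqrD !B0 add0r addr0 => /eqP.
by rewrite mulf_eq0 (negPf two_neq0) => /eqP.
Qed.

(** The isometry is the reflection in the hyperplane orthogonal to [w]; matrices
act on row vectors from the right. *)
Lemma reflection_isometry w :
  bilin B w w != 0 ->
  exists h : 'M[R]_n, [/\ h \in unitmx, h *m B *m h^T = B
    & forall x, x *m h = x - (2 * bilin B x w / bilin B w w) *: w].
Proof.
move=> Qw; set c := 2 / bilin B w w.
pose h := 1%:M - c *: (B *m w^T *m w).
have BwwB u (v : 'M_(n, u)) :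
    B *m w^T *m w *m (B *m w^T *m (w *m v)) =
    bilin B w w *: (B *m w^T *m (w *m v)).
  by rewrite !mulmxA -(mulmxA _ w B) -(mulmxA _ (w *m B)) bilinE mul_mx_scalar
             -!scalemxAl.
have c2 : c * (c * bilin B w w) = c + c by rewrite /c; field.
have hh : h *m h = 1%:M.
  have := BwwB _ 1%:M; rewrite mulmx1 => BB.
  rewrite /h mulmxBl mul1mx mulmxBr mulmx1 -scalemxAl -scalemxAr BB !scalerA.
  by rewrite -mulrA c2 scalerDl opprB addrK subrK.
exists h; split.
- by case/mulmx1_unit: hh.
- have -> : h^T = 1%:M - c *: (w^T *m w *m B).
    by rewrite /h linearB linearZ /= tr_scalar_mx !trmx_mul trmxK symB mulmxA.
  have := BwwB _ B => BB.
  rewrite /h mulmxBl mul1mx mulmxBr mulmx1 mulmxBl -!scalemxAl -!scalemxAr.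
  rewrite !mulmxA in BB *; rewrite BB.
  by rewrite !scalerA -mulrA c2 scalerDl opprB addrK subrK.
- move=> x; rewrite /h mulmxBr mulmx1 -scalemxAr !mulmxA bilinE mul_scalar_mx.
  by rewrite scalerA /c mulrAC.
Qed.

(** The reflection in [e - a] exchanges [e] and [a] when [e - a] is anisotropic.
Otherwise [e + a] is anisotropic, because the norms of [e - a] and [e + a] add
up to four times that of [a], and the reflection in [e + a] sends [e] to [- a]. *)
Lemma isometry_transitive a e :
  bilin B a a = bilin B e e -> bilin B a a != 0 ->
  exists h : 'M[R]_n, [/\ h \in unitmx, h *m B *m h^T = B & a = e *m h].
Proof.
move=> Qae Qa.
have [z | nz] := eqVneq (bilin B (e - a) (e - a)) 0; last first.
  have [h [hu hB hE]] := reflection_isometry nz.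
  exists h; split=> //; rewrite hE.
  have -> : 2 * bilin B e (e - a) = bilin B (e - a) (e - a).
    by rewrite bilin_sqrB bilinBr Qae; ring.
  by rewrite divff // scale1r opprB addrC subrK.
have nz : bilin B (e + a) (e + a) != 0.
  have -> : bilin B (e + a) (e + a) =
            2 * 2 * bilin B a a - bilin B (e - a) (e - a).
    by rewrite bilin_sqrB bilin_sqrD Qae; ring.
  by rewrite z subr0 !mulf_neq0.
have [h [hu hB hE]] := reflection_isometry nz.
exists (- h); split.
- by rewrite -scaleN1r unitmxZ ?rpredN ?unitr1.
- by rewrite linearN /= mulNmx mulmxN mulNmx opprK.
rewrite mulmxN hE.
have -> : 2 * bilin B e (e + a) = bilin B (e + a) (e + a).
  by rewrite bilin_sqrD bilinDr Qae; ring.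
by rewrite divff // scale1r opprB addrAC subrr add0r.
Qed.

End Reflections.

(** * Frames and orthogonal complements of unit vectors *)

Notation "1⊕ B" := (block_mx (1%:M : 'M_1) 0 0 B) (at level 20, B at level 20).

Section OrthogonalSumWithOne.
Variable R : fieldType.

Lemma dsum1_sym n (B : 'M[R]_n) : B^T = B -> (1⊕ B)^T = 1⊕ B.
Proof. by move=> sB; rewrite tr_block_mx !trmx0 sB tr_scalar_mx. Qed.

Lemma bilin_dsum1 n (B : 'M[R]_n) (x y : 'rV[R]_1) (u v : 'rV[R]_n) :
  bilin (1⊕ B) (row_mx x u) (row_mx y v) = x 0 0 * y 0 0 + bilin B u v.
Proof.
rewrite /bilin mul_row_block !mulmx0 addr0 add0r mulmx1 tr_row_mx mul_row_col.
by rewrite mxE [in LHS]mxE big_ord1 [y^T _ _]mxE.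
Qed.

Lemma mul_dsum1 k n l (A : 'M[R]_(k, n)) (C : 'M[R]_(n, l)) :
  1⊕ A *m 1⊕ C = 1⊕ (A *m C).
Proof. by rewrite mulmx_block !mul0mx !mulmx0 mulmx1 !addr0 !add0r. Qed.

Lemma tr_dsum1 k n (A : 'M[R]_(k, n)) : (1⊕ A)^T = 1⊕ A^T.
Proof. by rewrite tr_block_mx !trmx0 tr_scalar_mx. Qed.

(** A frame whose first vector is the first basis vector has its other vectors in
the orthogonal complement, where they form a frame of [T] in [B]. *)
Lemma gram_block k n (B : 'M[R]_n) (T : 'M[R]_k) (x : 'cV[R]_k)
    (Y : 'M[R]_(k, n)) :
  block_mx 1%:M 0 x Y *m 1⊕ B *m (block_mx 1%:M 0 x Y)^T = 1⊕ T <->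
  x = 0 /\ Y *m B *m Y^T = T.
Proof.
rewrite tr_block_mx !mulmx_block !trmx0 tr_scalar_mx.
rewrite !(mulmx0, mul0mx, mulmx1, mul1mx, addr0, add0r).
split=> [|[-> ->]]; last by rewrite trmx0 mul0mx add0r.
by case/eq_block_mx=> _ _ -> <-; rewrite mul0mx add0r.
Qed.

Hypothesis two_neq0 : 2 != 0 :> R.

Lemma unit_vector_isometry n (B : 'M[R]_n) (a : 'rV[R]_(1 + n)) :
  B^T = B -> a *m 1⊕ B *m a^T = 1%:M ->
  exists h : 'M[R]_(1 + n),
    [/\ h \in unitmx, h *m 1⊕ B *m h^T = 1⊕ B & a = row_mx 1%:M 0 *m h].
Proof.
move=> sB Qa; have Qa1 : bilin (1⊕ B) a a = 1 by rewrite /bilin Qa mxE.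
apply: isometry_transitive => //; first exact: dsum1_sym.
  by rewrite bilin_dsum1 Qa1 /bilin !mul0mx !mxE mulr1 addr0.
by rewrite Qa1 oner_neq0.
Qed.

Lemma first_row_unit k n (B : 'M[R]_n) (T : 'M[R]_k)
    (A : 'M[R]_(1 + k, 1 + n)) :
  A *m 1⊕ B *m A^T = 1⊕ T -> usubmx A *m 1⊕ B *m (usubmx A)^T = 1%:M.
Proof.
rewrite -{1 2}[A]vsubmxK tr_col_mx mul_col_mx mul_col_row.
by case/eq_block_mx.
Qed.

(** Once [h] moves the first basis vector to the first vector of the frame [A],
the rest of [A] comes from a frame [Y] of the complement. *)
Lemma frame_split k n (B : 'M[R]_n) (T : 'M[R]_k) (A : 'M[R]_(1 + k, 1 + n))
    (h : 'M[R]_(1 + n)) :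
    h \in unitmx -> h *m 1⊕ B *m h^T = 1⊕ B ->
    usubmx A = row_mx 1%:M 0 *m h ->
  A *m 1⊕ B *m A^T = 1⊕ T ->
  exists2 Y : 'M[R]_(k, n), A = 1⊕ Y *m h & Y *m B *m Y^T = T.
Proof.
move=> hu hB ae AB; pose A1 := dsubmx A *m invmx h.
have AE : A = block_mx 1%:M 0 (lsubmx A1) (rsubmx A1) *m h.
  by rewrite /block_mx hsubmxK mul_col_mx /A1 mulmxKV // -ae vsubmxK.
move: AB; rewrite AE trmx_mul mulmxA -(mulmxA _ h) -(mulmxA _ (h *m _)) hB.
case/gram_block => -> rT; by exists (rsubmx A1).
Qed.

End OrthogonalSumWithOne.

Section Frames.
Variable F : finFieldType.
Hypothesis two_neq0 : 2 != 0 :> F.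

(** Ordered families of [k] vectors, the rows of [A], with Gram matrix [T] for
the form [B].  For [T] equal to [B] this is the orthogonal group of [B]. *)
Definition frames n k (B : 'M[F]_n) (T : 'M[F]_k) : {set 'M[F]_(k, n)} :=
  [set A | A *m B *m A^T == T].

Definition sphere n (B : 'M[F]_n) (c : F) : nat := #|frames B (c%:M : 'M_1)|.

(** The first vector of a frame is any vector of norm 1; by transitivity of the
isometries the number of ways to complete it does not depend on it. *)
Lemma card_frames_dsum1 n k (B : 'M[F]_n) (T : 'M[F]_k) :
  B^T = B ->
  #|frames (1⊕ B) (1⊕ T)| = (sphere (1⊕ B) 1%R * #|frames B T|)%N.
Proof.
move=> sB; rewrite -sum1_card.
have uP A : A \in frames (1⊕ B) (1⊕ T) ->
    usubmx A \in frames (1⊕ B) (1%:M : 'M_1).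
  by rewrite !inE => /eqP/first_row_unit ->.
rewrite (partition_big (@usubmx _ 1 k (1 + n))
  (mem (frames (1⊕ B) (1%:M : 'M_1)))) /=; last exact: uP.
rewrite /sphere -sum_nat_const; apply: eq_bigr => a.
rewrite inE => /eqP Qa; rewrite sum1dep_card.
have [h [hu hB ae]] := unit_vector_isometry two_neq0 sB Qa.
rewrite -(card_imset (mem (frames B T)) (f := fun Y => 1⊕ Y *m h)); last first.
  by move=> Y Z /(can_inj (mulmxK hu)) /eq_block_mx[].
apply: eq_card => A; rewrite !inE; apply/andP/imsetP => [[/eqP AB /eqP uA]|].
  have [|Y AY YB] := frame_split hu hB _ AB; first by rewrite uA.
  by exists Y => //; rewrite inE YB.
case=> Y; rewrite inE => /eqP YB ->; split; apply/eqP.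
  rewrite trmx_mul mulmxA -(mulmxA _ h) -(mulmxA _ (h *m _)) hB.
  by apply/gram_block.
by rewrite -mul_usub_mx ae /block_mx col_mxKu.
Qed.

End Frames.

(** * Squares and spheres over a finite field *)

Section SquareClasses.
Variable F : finFieldType.
Hypothesis two_neq0 : 2 != 0 :> F.

(** The multiplicative group is cyclic, and [nu] is a generator: its even powers
are squares and its odd powers are [nu] times squares.  If [nu] were a square,
then squaring would be onto, hence injective, contradicting
[1 ^+ 2 = (-1) ^+ 2]. *)
Lemma square_classes :
  exists2 nu : F, forall x, x ^+ 2 != nu
    & forall a : F, exists x, a = x ^+ 2 \/ a = nu * x ^+ 2.
Proof.
have /cyclicP [g gE] := field_unit_group_cyclic [set: {unit F}]%G.
have sq a : exists x, a = x ^+ 2 \/ a = val g * x ^+ 2.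
  have [-> | nz] := eqVneq a 0; first by exists 0; left; rewrite expr0n.
  have au : a \is a GRing.unit by rewrite unitfE.
  pose u := FinRing.unit F au.
  have /cycleP [i ui] : u \in <[g]>%g by rewrite -gE inE.
  have -> : a = val g ^+ i by rewrite -FinRing.val_unitX -ui.
  exists (val g ^+ i./2); rewrite -exprM -exprS muln2.
  by case: (boolP (odd i)) => oi; [right | left]; rewrite -{1}[i]odd_double_half
    ?oi // (negPf oi).
exists (val g) => // x; apply/eqP => gx.
have sqr_surj (a : F) : exists y, a = y ^+ 2.
  have [y [-> | ->]] := sq a; first by exists y.
  by exists (x * y); rewrite exprMn gx.
have /fin_all_exists [r rE] := sqr_surj.
have inj : injective (fun y : F => y ^+ 2).
  by apply: can_inj (canF_sym (fun a => esym (rE a))).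
have := inj 1 (-1); rewrite sqrrN => /(_ erefl) /eqP.
by rewrite -subr_eq0 opprK (negPf two_neq0).
Qed.

End SquareClasses.

Section Spheres.
Variable F : finFieldType.
Hypothesis two_neq0 : 2 != 0 :> F.

Lemma sphereE n (B : 'M[F]_n) c : sphere B c = (\sum_(v | bilin B v v == c) 1)%N.
Proof.
rewrite sum1dep_card; apply: eq_card => v; rewrite !inE bilinE.
apply/eqP/eqP => [/(congr1 (fun M : 'M_1 => M 0 0))|->] //.
by rewrite !mxE !mulr1n.
Qed.

Lemma sum_sphere n (B : 'M[F]_n) : (\sum_c sphere B c = #|F| ^ n)%N.
Proof.
under eq_bigr => c _ do rewrite sphereE.
rewrite -(partition_big (fun v => bilin B v v) predT (P := predT)) //.
by rewrite sum1_card card_mx mul1n.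
Qed.

Lemma sphere_dsum1 n (B : 'M[F]_n) c :
  (sphere (1⊕ B) c = \sum_x sphere B (c - x ^+ 2)%R)%N.
Proof.
under eq_bigr => x _ do rewrite sphereE.
rewrite sphereE pair_big_dep /=.
rewrite (reindex (fun p : F * 'rV[F]_n => row_mx (p.1%:M : 'rV_1) p.2)) /=.
  apply: eq_bigl => -[x v] /=; rewrite bilin_dsum1 mxE mulr1n -expr2.
  by rewrite [RHS]eq_sym subr_eq eq_sym addrC.
exists (fun u : 'rV_(1 + n) => (lsubmx u 0 0, rsubmx u)) => [[x v] _ | u _] /=.
  by rewrite row_mxKr row_mxKl mxE mulr1n.
by rewrite -mx11_scalar hsubmxK.
Qed.

(** In the coordinates [u = x + i y], [v = x - i y] the plane contributes [u v].
For [u] nonzero, [c - u v] takes every value once as [v] varies, so the spheres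
of [B] add up to the whole space; [u = 0] gives [#|F|] times the sphere of
radius [c]. *)
Lemma sphere_hyperbolic n (B : 'M[F]_n) (i c : F) :
  i ^+ 2 = -1 ->
  sphere (1⊕ (1⊕ B)) c = ((#|F|.-1) * #|F| ^ n + #|F| * sphere B c)%N.
Proof.
move=> i2; rewrite sphere_dsum1.
under eq_bigr => x _ do rewrite sphere_dsum1.
rewrite pair_bigA /=.
have i0 : i != 0.
  by apply/eqP => i0; move/eqP: i2; rewrite i0 expr0n /= eq_sym oppr_eq0 oner_eq0.
rewrite (reindex (fun p : F * F =>
  ((p.1 + p.2) / 2, (p.1 - p.2) / (2 * i)))) /=; last first.
  exists (fun p : F * F => (p.1 + i * p.2, p.1 - i * p.2)) => -[x y] _ /=.
    by congr (_, _); field; rewrite two_neq0 i0.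
  by congr (_, _); field; rewrite ?two_neq0 ?i0.
rewrite -(pair_bigA _ (fun u v =>
  sphere B (c - ((u + v) / 2) ^+ 2 - ((u - v) / (2 * i)) ^+ 2))) /=.
have E u v : c - ((u + v) / 2) ^+ 2 - ((u - v) / (2 * i)) ^+ 2 = c - u * v.
  have four_neq0 : 4 != 0 :> F by rewrite (_ : 4 = 2 * 2) ?mulf_neq0 //; ring.
  by rewrite !exprMn !exprVn exprMn i2; field; rewrite oppr_eq0 four_neq0.
under eq_bigr => u _ do under eq_bigr => v _ do rewrite E.
rewrite (bigD1 0) //= addnC; congr (_ + _)%N; last first.
  under eq_bigr => v _ do rewrite mul0r subr0.
  by rewrite sum_nat_const.
rewrite (eq_bigr (fun=> #|F| ^ n)%N) => [|u u0].
  by rewrite sum_nat_const; congr (_ * _)%N; rewrite cardC1.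
rewrite -(sum_sphere B) [RHS](reindex (fun v => c - u * v)) //=.
exists (fun z => (c - z) / u) => z _; by field.
Qed.

Lemma sphere_empty c : sphere (0 : 'M[F]_0) c = (c == 0).
Proof.
rewrite sphereE.
under eq_bigl => v do rewrite /bilin mulmx0 mul0mx mxE eq_sym.
case: eqP => _; last by rewrite big_pred0.
by rewrite sum1_card card_mx muln0.
Qed.

Variable nu : F.
Hypothesis nu_nonsq : forall x, x ^+ 2 != nu.
Hypothesis sq_classes : forall a : F, exists x, a = x ^+ 2 \/ a = nu * x ^+ 2.

Lemma nu_neq0 : nu != 0.
Proof. by apply: contraNneq (nu_nonsq 0) => ->; rewrite expr0n. Qed.

Lemma sphere_line s c :
  sphere (s%:M : 'M[F]_1) c = #|[set x | s * x ^+ 2 == c]|.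
Proof.
rewrite sphereE -sum1dep_card (reindex (fun x : F => x%:M)) /=.
  apply: eq_bigl => x.
  by rewrite /bilin tr_scalar_mx -!scalar_mxM mxE mulr1n [x * s]mulrC -mulrA.
exists (fun v : 'rV_1 => v 0 0) => [x _ | v _]; first by rewrite mxE mulr1n.
by rewrite -mx11_scalar.
Qed.

Lemma sphere_line_self s : s != 0 -> sphere (s%:M : 'M[F]_1) s = 2%N.
Proof.
move=> s0; rewrite sphere_line -[RHS](_ : #|[set 1; -1 : F]|%SET = 2%N).
  apply: eq_card => x; rewrite !inE.
  rewrite -subr_eq0 -[X in _ - X]mulr1 -mulrBr mulf_eq0 (negPf s0).
  by rewrite subr_eq0 sqrf_eq1.
by rewrite cards2 -subr_eq0 opprK two_neq0.
Qed.

Lemma sphere_scale n (B : 'M[F]_n) c x :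
  x != 0 -> sphere B (c * x ^+ 2) = sphere B c.
Proof.
move=> x0; rewrite !sphereE (reindex (fun v : 'rV[F]_n => x *: v)) /=.
  apply: eq_bigl => v; rewrite /bilin linearZ /= -!scalemxAl -scalemxAr scalerA.
  by rewrite mxE mulrC -expr2 (inj_eq (mulIf _)) ?sqrf_eq0.
by exists (fun v => x^-1 *: v) => v _; rewrite scalerA (mulVf, mulfV) ?scale1r.
Qed.

Lemma sphere_line_nonsq (s t : F) : s != 0 -> (forall x, s * x ^+ 2 != t) ->
  sphere (s%:M : 'M[F]_1) t = 0%N.
Proof.
move=> s0 st; rewrite sphere_line; apply: eq_card0 => x; rewrite !inE.
exact: negPf (st x).
Qed.

Lemma sphere_line_1nu : sphere (1%:M : 'M[F]_1) nu = 0%N.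
Proof. by apply: sphere_line_nonsq => [|x]; rewrite ?oner_neq0 ?mul1r. Qed.

Lemma sphere_line_nu1 : sphere (nu%:M : 'M[F]_1) 1 = 0%N.
Proof.
apply: sphere_line_nonsq => [|x]; first exact: nu_neq0.
apply/eqP => x1; have /eqP := nu_nonsq x^-1; apply.
have x0 : x ^+ 2 != 0.
  by apply: contra_eq_neq x1 => ->; rewrite mulr0 eq_sym oner_neq0.
by apply: (mulIf x0); rewrite x1 exprVn mulVf.
Qed.

(** This symmetry between the two classes gives the spheres of the anisotropic
plane [x^2 + nu y^2] from those of the hyperbolic plane [x^2 + y^2]. *)
Lemma sphere_line_sum c :
  (sphere (1%:M : 'M[F]_1) c + sphere (nu%:M : 'M[F]_1) c = 2)%N.
Proof.
have [-> | c0] := eqVneq c 0.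
  have one (s : F) : s != 0 -> sphere (s%:M : 'M[F]_1) 0 = 1%N.
    move=> s0; rewrite sphere_line -[RHS](cards1 (0 : F)); apply: eq_card => x.
    by rewrite !inE mulf_eq0 (negPf s0) sqrf_eq0.
  by rewrite !one ?oner_neq0 ?nu_neq0.
have [x [cE | cE]] := sq_classes c.
  have x0 : x != 0 by apply: contraNneq c0; rewrite cE => ->; rewrite expr0n.
  by rewrite cE -[x ^+ 2]mul1r !sphere_scale // sphere_line_nu1
    sphere_line_self ?oner_neq0.
have x0 : x != 0 by apply: contraNneq c0; rewrite cE => ->; rewrite expr0n mulr0.
by rewrite cE !sphere_scale // sphere_line_1nu sphere_line_self ?nu_neq0.
Qed.

Lemma sphere_plane_sum c :
  (sphere (1⊕ (1%:M : 'M[F]_1)) c + sphere (1⊕ (nu%:M : 'M[F]_1)) c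
    = #|F| * 2)%N.
Proof.
rewrite !sphere_dsum1 -big_split /=.
by under eq_bigr => x _ do rewrite sphere_line_sum; rewrite sum_nat_const.
Qed.

End Spheres.

(** * Orders of the orthogonal groups *)

(** The matrix [diag(1, ..., 1, s)]; its size is [n.+1], so that the position of
[s] makes sense for all [n]. *)
Fixpoint std_form (R : fieldType) (n : nat) (s : R) : 'M[R]_n.+1 :=
  if n is n'.+1 then 1⊕ (std_form n' s) else s%:M.

Lemma std_form_sym (R : fieldType) n (s : R) : (std_form n s)^T = std_form n s.
Proof. by elim: n => [|n IH]; rewrite /= ?tr_scalar_mx ?dsum1_sym. Qed.

Lemma std_form1 (R : fieldType) n : std_form n (1 : R) = 1%:M.
Proof.
by elim: n => [|n IH] //=; rewrite IH -(@scalar_mx_block _ 1 n.+1).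
Qed.

Lemma det_std_form (R : fieldType) n (s : R) : \det (std_form n s) = s.
Proof.
by elim: n => [|n IH] /=; rewrite ?det_scalar1 // (@det_ublock _ 1 n.+1) det1 mul1r.
Qed.

Section StandardSpheres.
Variable F : finFieldType.
Hypothesis two_neq0 : 2 != 0 :> F.
Variable i nu : F.
Hypothesis i2 : i ^+ 2 = -1.
Hypothesis nu_nonsq : forall x, x ^+ 2 != nu.
Hypothesis sq_classes : forall a : F, exists x, a = x ^+ 2 \/ a = nu * x ^+ 2.

Let Q : rat := #|F|%:R.

Definition std_sphere n (s c : F) : rat := (sphere (std_form n s) c)%:R.

Lemma std_sphere_step n l s c :
  std_sphere (n + l.*2) s c =
  Q ^+ (n + l.*2) + (std_sphere n s c - Q ^+ n) * Q ^+ l.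
Proof.
elim: l => [|l IH]; first by rewrite addn0 expr0 mulr1 addrC subrK.
rewrite doubleS !addnS /std_sphere /= (sphere_hyperbolic two_neq0 _ _ i2).
rewrite natrD !natrM -/(std_sphere _ _ _) IH natrX -subn1 natrB; last first.
  by apply/card_gt0P; exists 0.
rewrite -/Q !exprS; ring.
Qed.

(** Here and below, odd and even refer to the dimension, which is one more than
the index. *)
Lemma std_sphere_odd l s c :
  std_sphere l.*2 s c = Q ^+ l * (Q ^+ l + (sphere (s%:M : 'M_1) c)%:R - 1).
Proof.
rewrite -[l.*2]add0n std_sphere_step add0n -addnn exprD expr0 /std_sphere /=.
by ring.
Qed.

Lemma std_sphere_even1 l c : c != 0 ->
  std_sphere l.*2.+1 1 c = Q ^+ l * (Q ^+ l.+1 - 1).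
Proof.
move=> c0; rewrite -[l.*2.+1]add1n std_sphere_step.
have -> : std_sphere 1 1 c = Q - 1.
  (* The hyperbolic plane is split off from the space of dimension 0. *)
  have -> : std_sphere 1 1 c = (sphere (1⊕ (1⊕ (0 : 'M[F]_0))) c)%:R.
    rewrite /std_sphere (_ : (0 : 'M[F]_0) = 1%:M); last by apply/matrixP => -[].
    by rewrite std_form1 -!(@scalar_mx_block _ 1).
  rewrite (sphere_hyperbolic two_neq0 _ _ i2) sphere_empty (negPf c0).
  by rewrite muln0 muln1 addn0 -subn1 natrB //; apply/card_gt0P; exists 0.
by rewrite add1n !exprS -addnn exprD; ring.
Qed.

Lemma std_sphere_even_nu l c : c != 0 ->
  std_sphere l.*2.+1 nu c = Q ^+ l * (Q ^+ l.+1 + 1).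
Proof.
move=> c0; rewrite -[l.*2.+1]add1n std_sphere_step.
have := std_sphere_even1 0 c0.
have /(congr1 (fun n => n%:R : rat)) :=
  sphere_plane_sum two_neq0 nu_nonsq sq_classes c.
rewrite natrD natrM -/(std_sphere 1 1 c) -/(std_sphere 1 nu c) -/Q => /[swap] -> h.
have -> : std_sphere 1 nu c = Q + 1.
  move: h; rewrite expr0 expr1 => h; apply: (addrI (1 * (Q - 1))); rewrite h; ring.
by rewrite add1n !exprS -addnn exprD; ring.
Qed.

Definition qprod l : rat := \prod_(1 <= h < l.+1) (Q ^+ h.*2 - 1).
(** [order_plus n] and [order_minus n] are the orders of the orthogonal groups of
[std_form n 1] and [std_form n nu].  In both products a factor counts the
choices of one unit vector, except that for [nu] the last vector has norm [nu]
in a line, which leaves two choices. *)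
Definition order_plus n : rat := \prod_(0 <= h < n.+1) std_sphere h 1 1.
Definition order_minus n : rat := 2 * \prod_(1 <= h < n.+1) std_sphere h nu 1.

Lemma qprodS l : qprod l.+1 = qprod l * ((Q ^+ l.+1 - 1) * (Q ^+ l.+1 + 1)).
Proof. by rewrite /qprod big_nat_recr //= -addnn exprD; congr (_ * _); ring. Qed.

Let a_odd l : std_sphere l.*2 1 1 = Q ^+ l * (Q ^+ l + 1).
Proof. by rewrite std_sphere_odd sphere_line_self ?oner_neq0 //; ring. Qed.

Lemma order_plus_odd l : order_plus l.*2 = 2 * Q ^+ (l * l) * qprod l.
Proof.
elim: l => [|l IH].
  rewrite /order_plus big_nat1 (a_odd 0) /qprod big_geq // !expr0; ring.
rewrite doubleS /order_plus 2?big_nat_recr //= -/(order_plus _) -doubleS a_odd.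
rewrite IH std_sphere_even1 ?oner_neq0 // qprodS.
by rewrite mulSn mulnS !exprD !exprS; ring.
Qed.

Lemma order_plus_even l :
  order_plus l.*2.+1 = 2 * Q ^+ (l * l + l) * (Q ^+ l.+1 - 1) * qprod l.
Proof.
rewrite /order_plus big_nat_recr //= -/(order_plus _) order_plus_odd.
by rewrite std_sphere_even1 ?oner_neq0 // exprD; ring.
Qed.

Lemma order_minus_odd l : order_minus l.*2 = 2 * Q ^+ (l * l) * qprod l.
Proof.
elim: l => [|l IH]; first by rewrite /order_minus /qprod !big_geq // expr0.
rewrite doubleS /order_minus 2?big_nat_recr //= 2!mulrA -/(order_minus _) IH.
rewrite -doubleS std_sphere_odd sphere_line_nu1 // std_sphere_even_nu ?oner_neq0 //.
by rewrite qprodS mulSn mulnS !exprD !exprS; ring.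
Qed.

Lemma order_minus_even l :
  order_minus l.*2.+1 = 2 * Q ^+ (l * l + l) * (Q ^+ l.+1 + 1) * qprod l.
Proof.
rewrite /order_minus big_nat_recr //= mulrA -/(order_minus _) order_minus_odd.
by rewrite std_sphere_even_nu ?oner_neq0 // exprD; ring.
Qed.

(** The first [k] vectors of a frame have norm 1 and are chosen in spaces of
decreasing dimension; the last one has norm [t] and is chosen in dimension
[d.+1]. *)
Lemma card_std_frames_mul d k s t :
  #|frames (std_form (k + d) s) (std_form k t)|%:R *
    \prod_(0 <= h < d.+1) std_sphere h s 1 =
  \prod_(0 <= h < (k + d).+1) std_sphere h s 1 * std_sphere d s t.
Proof.
elim: k => [|k IH]; first by rewrite add0n mulrC.
rewrite addSn /= card_frames_dsum1 ?std_form_sym // natrM -mulrA IH.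
by rewrite [in RHS]big_nat_recr //= [std_sphere (k + d).+1 s 1]/std_sphere /=; ring.
Qed.

Lemma card_frames_minus k :
  #|frames (std_form k nu) (std_form k nu)|%:R = order_minus k.
Proof.
elim: k => [|k IH] /=.
  rewrite -/(sphere _ _) sphere_line_self ?(nu_neq0 nu_nonsq) //.
  by rewrite /order_minus big_geq.
rewrite card_frames_dsum1 ?std_form_sym // natrM IH.
rewrite /order_minus [in RHS]big_nat_recr //=.
by rewrite [std_sphere k.+1 nu 1]/std_sphere /=; ring.
Qed.

End StandardSpheres.

(** * Classification of nondegenerate forms *)

Section Diagonalization.
Variable R : fieldType.

Lemma first_row_completion n (u : 'rV[R]_(1 + n)) :
  u != 0 -> exists2 P : 'M[R]_(1 + n), P \in unitmx & usubmx P = u.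
Proof.
move=> u0; have ru : \rank u = 1%N by rewrite rank_rV u0.
pose L : 'M[R]_(1 + n) := block_mx (col_ebase u) 0 0 1%:M.
exists (L *m row_ebase u).
  rewrite unitmx_mul row_ebase_unit andbT unitmxE /L det_ublock det1 mulr1.
  by rewrite -unitmxE col_ebase_unit.
rewrite -[RHS]mulmx_ebase ru -mul_usub_mx; congr (_ *m _).
rewrite /L /block_mx col_mxKu (_ : pid_mx 1 = row_mx 1%:M 0).
  by rewrite mul_mx_row mulmx1 mulmx0.
exact: pid_mx_row.
Qed.

(** Complete [u] to a basis, then subtract multiples of [u] from the other basis
vectors to make them orthogonal to [u]. *)
Lemma split_first_vector n (S : 'M[R]_(1 + n)) (u : 'rV[R]_(1 + n)) :
    S^T = S -> S \in unitmx -> bilin S u u != 0 ->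
  exists (P : 'M[R]_(1 + n)) (S' : 'M[R]_n),
    [/\ P \in unitmx, S'^T = S', S' \in unitmx
      & P *m S *m P^T = block_mx (bilin S u u)%:M 0 0 S'].
Proof.
move=> sS uS a0; set a := bilin S u u in a0 *.
have [|P0 uP0 P0u] := @first_row_completion _ u.
  by apply: contraNneq a0; rewrite /a => ->; rewrite /bilin !mul0mx mxE.
pose S1 := P0 *m S *m P0^T.
have sS1 : S1^T = S1 by rewrite /S1 !trmx_mul trmxK sS mulmxA.
have ul : ulsubmx S1 = a%:M.
  rewrite /S1 -[P0]vsubmxK P0u tr_col_mx mul_col_mx mul_col_row.
  by rewrite block_mxKul bilinE.
pose r := ursubmx S1.
have dl : dlsubmx S1 = r^T by rewrite /r -[in LHS]sS1 -trmx_ursub.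
have S1E : S1 = block_mx a%:M r r^T (drsubmx S1) by rewrite -{1}[S1]submxK ul dl.
pose L : 'M[R]_(1 + n) := block_mx 1%:M 0 (- a^-1 *: r^T) 1%:M.
have uL : L \in unitmx by rewrite unitmxE /L det_lblock !det1 mulr1 unitr1.
pose S' := drsubmx S1 - a^-1 *: (r^T *m r).
have E : (L *m P0) *m S *m (L *m P0)^T = block_mx a%:M 0 0 S'.
  rewrite trmx_mul !mulmxA -(mulmxA L) -(mulmxA L) -/S1 S1E /L.
  rewrite tr_block_mx !mulmx_block !trmx1 !trmx0 linearZ /= trmxK.
  rewrite !(mulmx0, mul0mx, mulmx1, mul1mx, addr0, add0r).
  rewrite -!scalemxAl -!scalemxAr mul_mx_scalar mul_scalar_mx !scalerA.
  rewrite !mulNr !mulVf // !scaleN1r !addNr.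
  by rewrite mul0mx scaler0 add0r scaleNr addrC.
have dS : drsubmx S1^T = drsubmx S1 by rewrite sS1.
exists (L *m P0), S'; split=> //.
- by rewrite unitmx_mul uL.
- by rewrite /S' linearB linearZ /= trmx_mul trmxK trmx_drsub dS.
have := congr1 (fun M => M \in unitmx) E.
rewrite !unitmx_mul unitmx_tr !unitmx_mul uL uP0 uS /= => /esym.
by rewrite !unitmxE det_ublock unitrM => /andP[].
Qed.

End Diagonalization.

Section Classification.
Variable F : finFieldType.
Hypothesis two_neq0 : 2 != 0 :> F.
Variable i nu : F.
Hypothesis i2 : i ^+ 2 = -1.
Hypothesis sq_classes : forall a : F, exists x, a = x ^+ 2 \/ a = nu * x ^+ 2.

Lemma exists_nonisotropic n (S : 'M[F]_n.+1) :
  S^T = S -> S \in unitmx -> exists u, bilin S u u != 0.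
Proof.
move=> sS uS; apply/existsP; apply: contraLR uS; rewrite negb_exists.
move=> /forallP S0; suff -> : S = 0 by rewrite unitmxE det0 unitr0.
by apply: bilin_diag_eq0 => // u; apply/eqP; have := S0 u; rewrite negbK.
Qed.

(** If [a] or [b] is a square, one variable is enough.  Otherwise both are [nu]
times a square, and the equation becomes [x'^2 + y'^2 = nu^-1], which the
hyperbolic coordinates solve. *)
Lemma binary_represents1 (a b : F) : a != 0 -> b != 0 ->
  exists x y, a * x ^+ 2 + b * y ^+ 2 = 1.
Proof.
move=> a0 b0; have [x [ax | ax]] := sq_classes a.
  exists x^-1, 0; rewrite expr0n mulr0 addr0 exprVn -ax mulfV //.
have [y [by_ | by_]] := sq_classes b.
  exists 0, y^-1; rewrite expr0n mulr0 add0r exprVn -by_ mulfV //.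
have i0 : i != 0.
  by apply/eqP => i0; move/eqP: i2; rewrite i0 expr0n eq_sym oppr_eq0 oner_eq0.
have [nu0 x0] : nu != 0 /\ x != 0.
  by apply/andP; move: a0; rewrite ax mulf_eq0 sqrf_eq0 negb_or.
have y0 : y != 0 by move: b0; rewrite by_ mulf_eq0 sqrf_eq0 negb_or => /andP[].
exists ((nu^-1 + 1) / (2 * x)), ((nu^-1 - 1) / (2 * i * y)).
have four_neq0 : 4 != 0 :> F by rewrite (_ : 4 = 2 * 2) ?mulf_neq0 //; ring.
rewrite ax by_ !exprMn !exprVn !exprMn i2.
by field; rewrite oppr_eq0 four_neq0 nu0 x0 y0.
Qed.

Lemma represents1 n (S : 'M[F]_n.+2) : S^T = S -> S \in unitmx ->
  exists u, bilin S u u = 1.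
Proof.
move=> sS uS; have [u u0] := exists_nonisotropic sS uS.
have [P [S' [uP sS' uS' PSP]]] := split_first_vector (n := n.+1) sS uS u0.
have [u' u'0] := exists_nonisotropic sS' uS'.
have [x [y xy]] := binary_represents1 u0 u'0.
exists (row_mx (x%:M : 'rV_1) (y *: u') *m P).
rewrite /bilin trmx_mul !mulmxA -(mulmxA _ P) -(mulmxA _ (P *m S)) PSP.
rewrite mul_row_block !mulmx0 addr0 add0r tr_row_mx mul_row_col tr_scalar_mx.
rewrite -!scalar_mxM linearZ /= -!scalemxAl -!scalemxAr scalerA bilinE.
rewrite !mxE !mulr1n -xy; ring.
Qed.

(** In dimension at least two the form represents 1, so a summand 1 can be split
off, until a line is left. *)
Lemma congruent_std_form n (S : 'M[F]_n.+1) : S^T = S -> S \in unitmx ->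
  exists P t, [/\ P \in unitmx, t = 1 \/ t = nu & P *m S *m P^T = std_form n t].
Proof.
elim: n S => [|n IH] S sS uS.
  move: uS; rewrite [S]mx11_scalar unitmxE det_scalar1 unitfE; set a := S 0 0 => a0.
  have [x ax] := sq_classes a.
  have x0 : x != 0.
    by apply: contraNneq a0 => x0; case: ax => ->; rewrite x0 expr0n ?mulr0.
  exists x^-1%:M, (if a == x ^+ 2 then 1 else nu); split.
  - by rewrite unitmxE det_scalar1 unitfE invr_eq0.
  - by case: eqP; [left | right].
  rewrite tr_scalar_mx -!scalar_mxM /=; congr _%:M.
  by case: eqP => [-> | /eqP axN];
    [|case: ax axN => ->; rewrite ?eqxx // => _]; field.
have [u u1] := represents1 sS uS.
have [|P [S' [uP sS' uS' PSP]]] := split_first_vector (n := n.+1) sS uS (u := u).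
  by rewrite u1 oner_neq0.
have [P' [t [uP' tt' PSP']]] := IH _ sS' uS'.
exists (1⊕ P' *m P), t; split=> //.
  rewrite unitmx_mul uP andbT unitmxE (@det_ublock _ 1 n.+1).
  by rewrite det1 mul1r -unitmxE.
rewrite trmx_mul !mulmxA -(mulmxA _ P) -(mulmxA _ (P *m S)) PSP u1.
by rewrite tr_dsum1 !mul_dsum1 PSP'.
Qed.

End Classification.

(** * Counting nondegenerate subspaces *)

Section SpacesOfFrames.
Variable F : finFieldType.

(** Subspaces are encoded by the canonical generating matrix of their row space,
so that equality of subspaces is equality of matrices. *)
Definition frame_spaces n k (B : 'M[F]_n) (T : 'M[F]_k) : {set 'M[F]_n} :=
  [set <<A>>%MS | A in frames B T].

Lemma gram_unit_row_free (R : fieldType) n k (B : 'M[R]_n) (A : 'M[R]_(k, n)) :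
  A *m B *m A^T \in unitmx -> row_free A.
Proof.
rewrite -row_free_unit -mulmxA -!row_leq_rank => /leq_trans; apply.
exact: mxrankM_maxl.
Qed.

(** The frames spanning the same subspace as [A0] are the [P *m A0] with [P]
preserving [T]. *)
Lemma card_frame_spaces n k (B : 'M[F]_n) (T : 'M[F]_k) : T \in unitmx ->
  (#|frame_spaces B T| * #|frames T T| = #|frames B T|)%N.
Proof.
move=> uT; rewrite -[RHS]sum1_card (partition_big_imset (fun A => <<A>>%MS)) /=.
rewrite -sum_nat_const; apply: eq_bigr => _ /imsetP[A0 A0P ->].
have /eqP A0E : A0 *m B *m A0^T == T by rewrite inE in A0P.
have fA0 : row_free A0 by apply: (@gram_unit_row_free _ _ _ B); rewrite A0E.
rewrite sum1dep_card -(card_imset (mem (frames T T)) (row_free_inj fA0)).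
apply: eq_card => A; rewrite !inE.
have gram (P : 'M_k) : P *m A0 *m B *m (P *m A0)^T = P *m T *m P^T.
  by rewrite -A0E trmx_mul !mulmxA.
apply/imsetP/andP => [[P]|[/eqP AE /eqP/genmxP/andP[/submxP[P AP] _]]].
  rewrite inE => /eqP PT ->; split; first by rewrite gram PT.
  apply/eqP/genmxP/eqmxP/eqmxMfull.
  rewrite row_full_unit; have : P *m T *m P^T \in unitmx by rewrite PT.
  by rewrite !unitmx_mul => /andP[/andP[]].
by exists P => //; rewrite inE -gram -AP AE.
Qed.

(** Two Gram matrices of one subspace are congruent, hence have the same
determinant up to a square. *)
Lemma disjoint_frame_spaces n k (B : 'M[F]_n) (T T' : 'M[F]_k) :
    (forall x, \det T' != x ^+ 2 * \det T) ->
  [disjoint frame_spaces B T & frame_spaces B T'].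
Proof.
move=> TT'; apply/pred0P => W /=; apply/negbTE/negP => /andP[].
case/imsetP => A; rewrite inE => /eqP AT -> /imsetP[A'].
rewrite inE => /eqP AT' /genmxP/andP[_ /submxP[P A'P]].
have /eqP := TT' (\det P); apply.
have -> : T' = P *m T *m P^T by rewrite -AT' A'P -AT trmx_mul !mulmxA.
by rewrite !det_mulmx det_tr expr2 mulrAC.
Qed.

End SpacesOfFrames.

Section CountNondegenerate.
Variable F : finFieldType.
Hypothesis two_neq0 : 2 != 0 :> F.
Variable nu : F.
Hypothesis nu_nonsq : forall x, x ^+ 2 != nu.

(** By the classification of forms, these are all the subspaces of dimension
[k.+1] in [F^(n.+1)] on which the sum of squares is nondegenerate. *)
Definition nondeg_spaces n k : {set 'M[F]_n.+1} :=
  frame_spaces 1%:M (std_form k 1) :|: frame_spaces 1%:M (std_form k nu).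

Lemma card_frames_gt0 k (T : 'M[F]_k) : (0 < #|frames T T|)%N.
Proof. by apply/card_gt0P; exists 1%:M; rewrite inE trmx1 mulmx1 mul1mx. Qed.

Lemma card_frames_plus k :
  #|frames (std_form k (1 : F)) (std_form k 1)|%:R = order_plus F k.
Proof.
have := card_std_frames_mul two_neq0 0 k (1 : F) 1; rewrite addn0 big_nat1.
apply: mulIf; rewrite /std_sphere sphere_line_self ?oner_neq0 //.
Qed.

(** With [d.+1] the dimension left for the last vector of a frame, each summand
is the number of frames of one class over the order of its orthogonal group. *)
Lemma card_nondeg_spaces k d :
  #|nondeg_spaces (k + d) k|%:R =
  order_plus F (k + d) / order_plus F d *
    (std_sphere d (1 : F) 1 / order_plus F k +
     std_sphere d 1 nu / order_minus nu k).
Proof.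
have nz (s : F) m : #|frames (std_form m s) (std_form m s)|%:R != 0 :> rat.
  by rewrite pnatr_eq0 -lt0n; exact: card_frames_gt0.
have pd : order_plus F d != 0 by rewrite -card_frames_plus nz.
have pk : order_plus F k != 0 by rewrite -card_frames_plus nz.
have nu0 := nu_neq0 nu_nonsq.
have mk : order_minus nu k != 0 by rewrite -card_frames_minus.
have count (t : F) : t != 0 ->
    #|frame_spaces (1%:M : 'M_((k + d).+1)) (std_form k t)|%:R *
    #|frames (std_form k t) (std_form k t)|%:R * order_plus F d =
    order_plus F (k + d) * std_sphere d 1 t.
  move=> t0; rewrite -natrM card_frame_spaces; last first.
    by rewrite unitmxE det_std_form unitfE.
  by rewrite -(std_form1 F (k + d)) card_std_frames_mul.
rewrite /nondeg_spaces cardsU disjoint_setI0 ?cards0 ?subn0; last first.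
  apply: disjoint_frame_spaces => x; rewrite !det_std_form mulr1 eq_sym.
  exact: nu_nonsq.
rewrite natrD.
have := count 1 (oner_neq0 _); rewrite card_frames_plus => c1.
have := count nu nu0; rewrite card_frames_minus // => cnu.
rewrite -[X in X + _](mulfK (mulf_neq0 pk pd)) mulrA c1.
rewrite -[X in _ + X](mulfK (mulf_neq0 mk pd)) mulrA cnu.
by field; rewrite pd pk mk.
Qed.

End CountNondegenerate.

(** * Closed forms of the counts *)

Section ClosedForms.
Variable F : finFieldType.
Hypothesis two_neq0 : 2 != 0 :> F.
Variable iu nu : F.
Hypothesis iu2 : iu ^+ 2 = -1.
Hypothesis nu_nonsq : forall x, x ^+ 2 != nu.
Hypothesis sq_classes : forall a : F, exists x, a = x ^+ 2 \/ a = nu * x ^+ 2.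

Let Q : rat := #|F|%:R.

Let Q_gt1 : 1 < Q.
Proof. by rewrite /Q ltr1n card_finNzRing_gt1. Qed.

Let Q_neq0 : Q != 0.
Proof. by rewrite gt_eqF // (lt_trans _ Q_gt1). Qed.

Let QX_neq1 h : Q ^+ h.+1 - 1 != 0.
Proof. by rewrite subr_eq0 gt_eqF // exprn_egt1. Qed.

Let QXp_neq0 h : Q ^+ h + 1 != 0.
Proof.
rewrite gt_eqF // ltr_wpDl //.
by apply: exprn_ge0; rewrite ler0n.
Qed.

Lemma qprod_neq0 h : qprod F h != 0.
Proof.
elim: h => [|h IH]; first by rewrite /qprod big_geq // oner_neq0.
by rewrite qprodS !mulf_neq0.
Qed.

Lemma qbinom_qprod i j :
  qbinom (Q ^+ 2) (i + j) j = qprod F (i + j) / (qprod F j * qprod F i).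
Proof.
have factE h : qfact (Q ^+ 2) h = qprod F h / (Q ^+ 2 - 1) ^+ h.
  elim: h => [|h IH].
    by rewrite /qfact /qprod !big_geq // expr0 divr1.
  rewrite /qfact big_nat_recr //= -/(qfact _ h) IH /qint.
  rewrite [in RHS]/qprod big_nat_recr //= -/(qprod F h) -/Q.
  rewrite -exprM mul2n [(_ - 1) ^+ h.+1]exprS; field.
  by rewrite -[1 - _]opprB oppr_eq0 (QX_neq1 1) expf_neq0 // (QX_neq1 1).
rewrite /qbinom addnK !factE exprD; field.
by rewrite !qprod_neq0 !expf_neq0 // QX_neq1.
Qed.

Let nondeg k d := card_nondeg_spaces two_neq0 nu_nonsq k d.

Let aO l : std_sphere l.*2 (1 : F) 1 = Q ^+ l * (Q ^+ l + 1).
Proof.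
by rewrite (std_sphere_odd two_neq0 iu2) sphere_line_self ?oner_neq0 //; ring.
Qed.

Let a_even l c : c != 0 ->
  std_sphere l.*2.+1 (1 : F) c = Q ^+ l * (Q ^+ l.+1 - 1).
Proof. exact: (std_sphere_even1 two_neq0 iu2). Qed.

Let c_odd l : std_sphere l.*2 1 nu = Q ^+ l * (Q ^+ l - 1).
Proof. by rewrite (std_sphere_odd two_neq0 iu2) sphere_line_1nu // addr0. Qed.

Let oPe l : order_plus F l.*2.+1 =
  2 * Q ^+ (l * l + l) * (Q ^+ l.+1 - 1) * qprod F l.
Proof. exact: (order_plus_even two_neq0 iu2). Qed.

Let oPo l : order_plus F l.*2 = 2 * Q ^+ (l * l) * qprod F l.
Proof. exact: (order_plus_odd two_neq0 iu2). Qed.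

Let oMe l : order_minus nu l.*2.+1 =
  2 * Q ^+ (l * l + l) * (Q ^+ l.+1 + 1) * qprod F l.
Proof. exact: (order_minus_even two_neq0 iu2). Qed.

Let oMo l : order_minus nu l.*2 = 2 * Q ^+ (l * l) * qprod F l.
Proof. exact: (order_minus_odd two_neq0 iu2). Qed.

Let sqr_exp i j : Q ^+ ((i + j) * (i + j)) =
  Q ^+ (i * i) * Q ^+ (j * j) * Q ^+ (i * j) ^+ 2.
Proof. by rewrite -exprM -!exprD; congr (_ ^+ _); lia. Qed.

(** The four lemmas are named after the parities of the dimensions of the
subspace and of the whole space, and are rational identities between the powers
of [Q] that occur, these being independent unknowns once the exponents are
split.  The complement of the subspace has dimension [i.*2] or [i.*2.+1]. *)
Lemma card_nondeg_even_even i j :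
  #|nondeg_spaces nu (j.*2.+1 + i.*2) j.*2.+1|%:R =
  Q ^+ (2 * i * j.+1) * qbinom (Q ^+ 2) (i + j.+1) j.+1.
Proof.
rewrite (nondeg j.*2.+1 i.*2) qbinom_qprod aO c_odd.
rewrite addSn -doubleD !oPe oPo oMe.
rewrite addnS !qprodS (addnC j i).
rewrite (_ : 2 * i * j.+1 = i * j * 2 + i * 2)%N; last by lia.
rewrite !(exprD, exprM Q _ 2) sqr_exp.
have := QX_neq1 j; have := QXp_neq0 j.+1; rewrite !exprS exprD.
have := expf_neq0 (i * i) Q_neq0; have := expf_neq0 (j * j) Q_neq0.
have := expf_neq0 i Q_neq0; have := expf_neq0 j Q_neq0.
have := qprod_neq0 i; have := qprod_neq0 j; have := Q_neq0.
move: (Q ^+ (i * i)) (Q ^+ (j * j)) (Q ^+ (i * j)) (Q ^+ i) (Q ^+ j).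
move: (qprod F i) (qprod F j) (qprod F (i + j)) Q.
move=> pi pj pij q xii xjj xij x y q0 pj0 pi0 y0 x0 xjj0 xii0 h1 h2.
by field; rewrite pi0 h1 h2 pj0 y0 xjj0 xii0.
Qed.

Lemma card_nondeg_even_odd i j :
  #|nondeg_spaces nu (j.*2.+1 + i.*2.+1) j.*2.+1|%:R =
  Q ^+ (2 * i * j.+1 + 2 * j.+1) * qbinom (Q ^+ 2) (i + j.+1) j.+1.
Proof.
rewrite (nondeg j.*2.+1 i.*2.+1) qbinom_qprod !a_even ?oner_neq0 //;
  last exact: nu_neq0.
rewrite (_ : j.*2.+1 + i.*2.+1 = (i + j.+1).*2)%N; last by lia.
rewrite !oPe oPo oMe qprodS.
rewrite (_ : 2 * i * j.+1 + 2 * j.+1 = i * j.+1 * 2 + j.+1 * 2)%N; last by lia.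
rewrite sqr_exp mulSn mulnS !(exprD, exprM Q _ 2) !(exprS _ j).
have := QX_neq1 j; have := QXp_neq0 j.+1; have := QX_neq1 i; rewrite (exprS _ j).
have := expf_neq0 (i * i) Q_neq0; have := expf_neq0 (j * j) Q_neq0.
have := expf_neq0 i Q_neq0; have := expf_neq0 j Q_neq0.
have := qprod_neq0 i; have := qprod_neq0 j; have := Q_neq0.
move: (Q ^+ (i * i)) (Q ^+ (j * j)) (Q ^+ (i * j.+1)).
move: (Q ^+ i) (Q ^+ j) (Q ^+ i.+1).
move: (qprod F i) (qprod F j) (qprod F (i + j.+1)) Q.
move=> pi pj pij q x y xq xii xjj xij q0 pj0 pi0 y0 x0 xjj0 xii0 h1 h2 h3.
by field; rewrite !(q0, pi0, h1, h2, h3, pj0, x0, y0, xjj0, xii0).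
Qed.

Lemma card_nondeg_odd_odd i j :
  #|nondeg_spaces nu (j.*2 + i.*2) j.*2|%:R =
  Q ^+ (2 * i * j + 2 * i) * qbinom (Q ^+ 2) (i + j) j.
Proof.
rewrite (nondeg j.*2 i.*2) qbinom_qprod aO c_odd -doubleD addnC !oPo oMo.
rewrite (_ : 2 * i * j + 2 * i = i * j * 2 + i * 2)%N; last by lia.
rewrite sqr_exp !(exprD, exprM Q _ 2).
have := expf_neq0 (i * i) Q_neq0; have := expf_neq0 (j * j) Q_neq0.
have := qprod_neq0 i; have := qprod_neq0 j.
move: (Q ^+ (i * i)) (Q ^+ (j * j)) (Q ^+ (i * j)) (Q ^+ i).
move: (qprod F i) (qprod F j) (qprod F (i + j)).
move=> pi pj pij xii xjj xij x pj0 pi0 xjj0 xii0.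
by field; rewrite pi0 pj0 xjj0 xii0.
Qed.

Lemma card_nondeg_odd_even i j :
  #|nondeg_spaces nu (j.*2 + i.*2.+1) j.*2|%:R =
  Q ^+ (2 * i * j + i + j) * qbinom (Q ^+ 2) (i + j) j * (Q ^+ (i + j).+1 - 1).
Proof.
rewrite (nondeg j.*2 i.*2.+1) qbinom_qprod !a_even ?oner_neq0 //;
  last exact: nu_neq0.
rewrite addnS -doubleD (addnC j) !oPe !oPo oMo.
rewrite (_ : 2 * i * j + i + j = i * j * 2 + i + j)%N; last by lia.
rewrite !(exprD, exprM Q _ 2) sqr_exp.
have := QX_neq1 i.
have := expf_neq0 (i * i) Q_neq0; have := expf_neq0 (j * j) Q_neq0.
have := expf_neq0 i Q_neq0.
have := qprod_neq0 i; have := qprod_neq0 j.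
move: (Q ^+ (i * i)) (Q ^+ (j * j)) (Q ^+ (i * j)).
move: (Q ^+ (i + j).+1) (Q ^+ i) (Q ^+ j) (Q ^+ i.+1).
move: (qprod F i) (qprod F j) (qprod F (i + j)).
move=> pi pj pij xm x y xq xii xjj xij pj0 pi0 x0 xjj0 xii0 h1.
by field; rewrite pi0 h1 pj0 xjj0 x0 xii0.
Qed.

End ClosedForms.

(** * Rational points of the Grassmannian *)

Section OrthogonalExtension.
Variable K : fieldType.
Hypothesis two_neq0 : 2 != 0 :> K.

Lemma dsum1_scalar n : 1⊕ (1%:M : 'M[K]_n) = 1%:M.
Proof. by rewrite -scalar_mx_block. Qed.

Lemma pid_mx_dsum1 k n : (pid_mx k.+1 : 'M[K]_(1 + k, 1 + n)) = 1⊕ (pid_mx k).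
Proof.
apply/matrixP => a b; rewrite !mxE.
case: (splitP a) => a' aa'; rewrite !mxE; case: (splitP b) => b' bb';
  rewrite !mxE ?ord1 ?aa' ?bb' ?ord1 //=.
Qed.

(** Each vector of the orthonormal family [A] is moved in turn to a basis vector
by an isometry that fixes the previous ones. *)
Lemma orthonormal_extension k n (A : 'M[K]_(k, n)) : A *m A^T = 1%:M ->
  exists2 h : 'M[K]_n, h *m h^T = 1%:M & A = pid_mx k *m h.
Proof.
elim: k n A => [|k IH] n A AA.
  exists 1%:M; first by rewrite trmx1 mulmx1.
  by apply/matrixP => -[].
case: n A AA => [|n] A AA.
  have := congr1 (fun M : 'M_k.+1 => M 0 0) AA; rewrite [A]thinmx0 mul0mx !mxE.
  by move=> /eqP; rewrite eq_sym oner_eq0.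
have AA1 : A *m 1⊕ (1%:M : 'M_n) *m A^T = 1⊕ (1%:M : 'M_k).
  by rewrite !dsum1_scalar mulmx1.
have [h [hu hB ah]] :=
  unit_vector_isometry two_neq0 (trmx1 _ _) (first_row_unit AA1).
have [Y AY YY] := frame_split hu hB ah AA1.
have [|h' h'1 Yh'] := IH _ Y; first by rewrite -YY mulmx1.
exists (1⊕ h' *m h).
  move: hB; rewrite trmx_mul mulmxA -(mulmxA _ h) dsum1_scalar mulmx1 => ->.
  by rewrite mulmx1 tr_dsum1 mul_dsum1 h'1 dsum1_scalar.
by rewrite mulmxA (@pid_mx_dsum1 k n) mul_dsum1 -Yh'.
Qed.

(** Changing the sign of the first row of [h] changes the determinant but not the
span of the first rows. *)
Lemma special_orthonormal_extension k n (A : 'M[K]_(k.+1, n.+1)) :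
  A *m A^T = 1%:M ->
  exists h : 'M[K]_n.+1, [/\ h *m h^T = 1%:M, \det h = 1
    & (A :=: (pid_mx k.+1 : 'M_(k.+1, n.+1)) *m h)%MS].
Proof.
move=> /orthonormal_extension[h hh ->].
have [h1 | hN1] := eqVneq (\det h) 1; first by exists h.
have {}hN1 : \det h = -1.
  have /eqP := congr1 determinant hh.
  by rewrite det_mulmx det_tr det1 -expr2 sqrf_eq1 (negPf hN1) => /eqP.
pose D m : 'M[K]_(1 + m) := block_mx (-1)%:M 0 0 1%:M.
have DD m : D m *m (D m)^T = 1%:M.
  rewrite /D tr_block_mx !trmx0 !tr_scalar_mx mulmx_block.
  by rewrite !mulmx0 !mul0mx !addr0 !add0r -!scalar_mxM mulrNN mulr1 dsum1_scalar.
exists (D n *m h); split.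
- by rewrite trmx_mul mulmxA -(mulmxA _ h) hh mulmx1 DD.
- by rewrite det_mulmx hN1 (@det_ublock _ 1 n) det_scalar1 det1 mulr1 mulrNN mulr1.
have -> : (pid_mx k.+1 : 'M[K]_(k.+1, n.+1)) *m (D n *m h) =
          D k *m (pid_mx k.+1 *m h).
  rewrite !mulmxA; congr (_ *m _); rewrite (@pid_mx_dsum1 k n).
  by rewrite /D (@mulmx_block _ 1 k 1 n 1 n) (@mulmx_block _ 1 k 1 k 1 n)
    !(mulmx0, mul0mx, mulmx1, mul1mx, addr0, add0r).
apply: eqmx_sym; apply: eqmxMfull; rewrite row_full_unit.
by have [] := mulmx1_unit (DD k).
Qed.

Lemma sumsqE n (v : 'cV[K]_n) : sumsq v = bilin 1%:M v^T v^T.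
Proof.
by rewrite /bilin mulmx1 trmxK mxE; apply: eq_bigr => a _; rewrite mxE expr2.
Qed.

Lemma SOnP n (g : 'M[K]_n) : SOn n g <-> g^T *m g = 1%:M /\ \det g = 1.
Proof.
split=> -[gE dg]; split=> //; last first.
  move=> v; rewrite !sumsqE /bilin !mulmx1 !(trmx_mul, trmxK).
  by rewrite mulmxA -(mulmxA _ g^T) gE mulmx1.
apply/eqP; rewrite -subr_eq0; apply/eqP; apply: bilin_diag_eq0 => // [|u].
  by rewrite linearB /= trmx_mul trmxK trmx1.
have := gE u^T; rewrite !sumsqE /bilin !(trmx_mul, trmxK) !mulmx1 mulmxBr mulmxBl.
have subE (X Y : 'M[K]_1) : (X - Y) 0 0 = X 0 0 - Y 0 0 by rewrite !mxE.
by rewrite mulmx1 !mulmxA subE => ->; rewrite subrr.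
Qed.

End OrthogonalExtension.

Section ColumnSpaces.
Variable K : fieldType.

(** The span of the rows of [M], seen as columns; this turns statements about
abstract subspaces of columns into statements about row spaces of matrices. *)
Definition row_vspace r n (M : 'M[K]_(r, n)) : {vspace 'cV[K]_n} :=
  limg (linfun (mulmx M^T : 'cV[K]_r -> 'cV[K]_n)).

Lemma mem_row_vspace r n (M : 'M[K]_(r, n)) v :
  (v \in row_vspace M) = (v^T <= M)%MS.
Proof.
apply/memv_imgP/submxP => [[u _ ->]|[D vD]].
  by exists u^T; rewrite lfunE /= trmx_mul trmxK.
by exists D^T; rewrite ?memvf // lfunE /= -trmx_mul -vD trmxK.
Qed.

Lemma eq_row_vspace r1 r2 n (M : 'M[K]_(r1, n)) (N : 'M[K]_(r2, n)) :
  row_vspace M = row_vspace N <-> (M :=: N)%MS.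
Proof.
split=> [MN | MN]; last by apply/vspaceP => v; rewrite !mem_row_vspace MN.
apply/eqmxP/andP; split; apply/rV_subP => v; rewrite -[v]trmxK -!mem_row_vspace.
  by rewrite MN.
by rewrite -MN.
Qed.

Lemma span_rows r n (M : 'M[K]_(r, n)) :
  <<[seq (row a M)^T | a <- enum 'I_r]>>%VS = row_vspace M.
Proof.
apply/eqP; rewrite eqEsubv; apply/andP; split.
  by apply/span_subvP => _ /mapP[a _ ->]; rewrite mem_row_vspace trmxK row_sub.
apply/subvP => v; rewrite mem_row_vspace => /submxP[D vD].
rewrite -[v]trmxK vD mulmx_sum_row raddf_sum /=; apply: memv_suml => a _.
rewrite linearZ /= memvZ // memv_span //.
by apply/mapP; exists a; rewrite ?mem_enum.
Qed.

Lemma img_row_vspace r n (g : 'M[K]_n) (M : 'M[K]_(r, n)) :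
  (linfun (mulmx g) @: row_vspace M)%VS = row_vspace (M *m g^T).
Proof.
apply/vspaceP => v; rewrite mem_row_vspace; apply/memv_imgP/submxP => [[u]|[D vD]].
  rewrite mem_row_vspace => /submxP[D uD] ->; exists D.
  by rewrite lfunE /= trmx_mul uD mulmxA.
exists (D *m M)^T; first by rewrite mem_row_vspace trmxK submxMl.
by rewrite lfunE /= -[v]trmxK vD !trmx_mul trmxK mulmxA.
Qed.

Lemma std_subspaceE k n : (k <= n)%N ->
  std_subspace k n = row_vspace (pid_mx k : 'M[K]_(k, n)).
Proof.
move=> kn; rewrite /std_subspace.
have rowE (a : 'I_k) :
    (row a (pid_mx k : 'M[K]_(k, n)))^T = delta_mx (widen_ord kn a) 0.
  apply/colP => b; rewrite !mxE andbT ltn_ord andbT; congr (_%:R).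
  by rewrite eq_sym.
rewrite -span_rows; apply/eqP; rewrite eqEsubv; apply/andP; split.
  apply/span_subvP => _ /mapP[b + ->]; rewrite mem_filter => /andP[bk _].
  have -> : delta_mx b 0 = delta_mx (widen_ord kn (Ordinal bk)) 0 :> 'cV[K]_n.
    by congr delta_mx; exact: val_inj.
  by rewrite -rowE; apply/memv_span/mapP; exists (Ordinal bk); rewrite ?mem_enum.
apply/span_subvP => _ /mapP[a _ ->]; rewrite rowE memv_span //.
by apply: map_f; rewrite mem_filter /= ltn_ord mem_enum.
Qed.

End ColumnSpaces.

Section RationalSpaces.
Variables (F : finFieldType) (K : closedFieldType) (iota : {rmorphism F -> K}).
Hypothesis two_neq0 : 2 != 0 :> F.
Variable i nu : F.
Hypothesis i2 : i ^+ 2 = -1.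
Hypothesis nu_nonsq : forall x, x ^+ 2 != nu.
Hypothesis sq_classes : forall a : F, exists x, a = x ^+ 2 \/ a = nu * x ^+ 2.

Local Notation "M ^i" := (map_mx iota M) (at level 2, format "M ^i").

Lemma two_neq0_closure : 2 != 0 :> K.
Proof. by rewrite -(rmorph_nat iota) fmorph_eq0. Qed.

Lemma eq_row_vspace_map r1 r2 n (M : 'M[F]_(r1, n)) (N : 'M[F]_(r2, n)) :
  row_vspace M^i = row_vspace N^i <-> (M :=: N)%MS.
Proof.
split=> [/eq_row_vspace/eqmxP | /eqmxP MN].
  by rewrite !map_submx => /eqmxP.
by apply/eq_row_vspace/eqmxP; rewrite !map_submx.
Qed.

Lemma defined_overP n (U : {vspace 'cV[K]_n}) :
  defined_over iota U <-> exists W : 'M[F]_n, U = row_vspace W^i.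
Proof.
split=> [[X ->]|[W ->]]; last first.
  exists [seq (row a W)^T | a <- enum 'I_n].
  rewrite -map_comp -span_rows; congr <<_>>%VS; apply: eq_map => a /=.
  by rewrite -map_trmx map_row.
pose M : 'M[F]_(size X, n) := \matrix_a (tnth (in_tuple X) a)^T.
exists <<M>>%MS.
have -> : row_vspace <<M>>%MS^i = row_vspace M^i.
  by apply/eq_row_vspace_map; exact: genmxE.
rewrite -span_rows (_ : [seq map_mx iota v | v <- X] =
  [seq map_mx iota (tnth (in_tuple X) a) | a <- enum 'I_(size X)]); last first.
  by rewrite (map_comp (map_mx iota) (tnth (in_tuple X))) map_tnth_enum.
by congr <<_>>%VS; apply: eq_map => a /=; rewrite -map_row rowK map_trmx trmxK.
Qed.

Lemma exists_sqrt (t : K) : exists s, s ^+ 2 = t.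
Proof.
have [s sE] := @solve_monicpoly K 2 (fun l => if l == 0%N then t else 0) isT.
by exists s; rewrite sE !big_ord_recl big_ord0 /= mulr1 mul0r !addr0.
Qed.

Lemma mul_std_form (R : fieldType) n (s t : R) :
  std_form n s *m std_form n t = std_form n (s * t).
Proof. by elim: n => [|n IH] /=; rewrite -?scalar_mxM // mul_dsum1 IH. Qed.

Lemma map_std_form n (s : F) : (std_form n s)^i = std_form n (iota s).
Proof.
elim: n => [|n IH] /=; first by rewrite map_scalar_mx.
by rewrite (@map_block_mx _ _ _ 1 n.+1 1 n.+1) !map_mx0 map_scalar_mx rmorph1 IH.
Qed.

(** The rows of [A0] form a basis of [U] over [F], those of [E] one over [K]
which is orthonormal; as they differ by an invertible [P] over [K], the Gram
matrix of [A0] is [P *m P^T], hence invertible. *)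
Lemma Gr_points_sub_nondeg k n (U : {vspace 'cV[K]_n.+1}) : (k <= n)%N ->
  Gr_points iota k.+1 n.+1 U ->
  exists2 W, W \in nondeg_spaces nu n k & row_vspace W^i = U.
Proof.
move=> kn [[g /(SOnP two_neq0_closure)[gg _] gU] /defined_overP[M UM]].
pose E : 'M[K]_(k.+1, n.+1) := pid_mx k.+1 *m g^T.
have EE : E *m E^T = 1%:M.
  rewrite /E trmx_mul trmxK mulmxA -(mulmxA _ g^T) gg mulmx1 tr_pid_mx.
  by rewrite pid_mx_id // pid_mx_1.
have ME : (M^i :=: E)%MS.
  by apply/eq_row_vspace; rewrite -UM -gU std_subspaceE // img_row_vspace.
have rM : \rank M = k.+1.
  rewrite -(mxrank_map iota) ME; apply/eqP.
  have := @gram_unit_row_free _ _ _ 1%:M E.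
  by rewrite mulmx1 EE unitmx1 => /(_ isT).
have [A0 A0M] : exists A0 : 'M[F]_(k.+1, n.+1), (A0 :=: M)%MS.
  by rewrite -rM; exists (row_base M); exact: eq_row_base.
have A0E : (A0^i :=: E)%MS.
  by apply: eqmx_trans ME; apply/eqmxP; rewrite !map_submx; apply/eqmxP.
have /submxP[P A0P] : (A0^i <= E)%MS by rewrite A0E.
have uP : P \in unitmx.
  rewrite -row_free_unit -row_leq_rank; apply: leq_trans (mxrankM_maxl P E).
  by rewrite -A0P mxrank_map A0M rM.
have uS : A0 *m A0^T \in unitmx.
  rewrite -(map_unitmx iota) map_mxM /= -map_trmx A0P trmx_mul mulmxA.
  by rewrite -(mulmxA P) EE mulmx1 unitmx_mul unitmx_tr uP.
have sS : (A0 *m A0^T)^T = A0 *m A0^T by rewrite trmx_mul trmxK.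
have [Q [t [uQ tt QS]]] := congruent_std_form two_neq0 i2 sq_classes sS uS.
exists <<Q *m A0>>%MS.
  rewrite /nondeg_spaces finset.in_setU.
  have QA : Q *m A0 \in frames 1%:M (std_form k t).
    by rewrite inE mulmx1 trmx_mul mulmxA -(mulmxA Q) QS.
  by case: tt QA => -> QA; rewrite (imset_f (fun A => <<A>>%MS) QA) ?orbT.
rewrite UM; apply/eq_row_vspace_map.
apply: eqmx_trans (genmxE _) _; apply: eqmx_trans A0M.
by apply: eqmxMfull; rewrite row_full_unit.
Qed.

(** A frame of [diag(1, ..., 1, t)] becomes orthonormal over [K] when its last
vector is divided by a square root of [t]. *)
Lemma nondeg_sub_Gr_points k n W : (k <= n)%N ->
  W \in nondeg_spaces nu n k -> Gr_points iota k.+1 n.+1 (row_vspace W^i).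
Proof.
move=> kn WP; have nu0 := nu_neq0 nu_nonsq.
have [A [t [t0 AT ->]]] : exists (A : 'M[F]_(k.+1, n.+1)) t,
    [/\ t != 0, A *m A^T = std_form k t & W = <<A>>%MS].
  move: WP; rewrite /nondeg_spaces finset.in_setU => /orP[] /imsetP[A];
    rewrite inE mulmx1 => /eqP AT ->; exists A; [exists 1 | exists nu]; split=> //.
  exact: oner_neq0.
split; last by apply/defined_overP; exists <<A>>%MS.
have [s s2] := exists_sqrt (iota t).
have s0 : s != 0 by rewrite -sqrf_eq0 s2 fmorph_eq0.
pose A' := std_form k s^-1 *m A^i.
have A'A' : A' *m A'^T = 1%:M.
  rewrite /A' trmx_mul mulmxA -(mulmxA (std_form _ _)) map_trmx -map_mxM AT.
  rewrite map_std_form std_form_sym !mul_std_form -s2 -(std_form1 K k).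
  by congr std_form; field.
have [h [hh dh A'h]] := special_orthonormal_extension two_neq0_closure A'A'.
exists h^T; first by apply/(SOnP two_neq0_closure); rewrite trmxK det_tr.
have -> : row_vspace <<A>>%MS^i = row_vspace A^i.
  by apply/eq_row_vspace_map; exact: genmxE.
rewrite std_subspaceE // img_row_vspace trmxK; apply/eq_row_vspace.
apply: eqmx_trans (eqmx_sym A'h) _; apply: eqmxMfull.
by rewrite row_full_unit unitmxE det_std_form unitfE invr_eq0.
Qed.

Lemma Gr_points_nondeg k n : (k <= n)%N ->
  Gr_points iota k.+1 n.+1 =
  [set row_vspace W^i | W in [set` nondeg_spaces nu n k]]%classic.
Proof.
move=> kn; apply/seteqP.
split=> [U /(Gr_points_sub_nondeg kn)[W WP <-] | _ [W WP <-]].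
  by exists W.
exact: nondeg_sub_Gr_points.
Qed.

Lemma row_vspace_inj_nondeg n k :
  {in nondeg_spaces nu n k &, injective (fun W => row_vspace W^i)}.
Proof.
have gen W : W \in nondeg_spaces nu n k -> <<W>>%MS = W.
  rewrite /nondeg_spaces finset.in_setU => /orP[] /imsetP[A _ ->];
    by rewrite genmx_id.
move=> W W' /gen Wgen /gen W'gen /eq_row_vspace_map/eqmxP WW'.
by rewrite -Wgen -W'gen; apply/genmxP.
Qed.

Lemma card_Gr_points k n : (k <= n)%N ->
  finite_set (Gr_points iota k.+1 n.+1) /\
  #|` fset_set (Gr_points iota k.+1 n.+1)| = #|nondeg_spaces nu n k|.
Proof.
move=> kn; rewrite Gr_points_nondeg //.
have fin : finite_set [set` nondeg_spaces nu n k]%classic by exact: finite_finset.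
split; first exact: finite_image.
rewrite fset_set_image // card_in_imfset /=; last first.
  move=> W W'; rewrite !in_fset_set // !mem_setE; exact: row_vspace_inj_nondeg.
rewrite cardE; apply: perm_size.
apply: uniq_perm; rewrite ?enum_uniq ?fset_uniq //= => W.
by rewrite in_fset_set // mem_setE mem_enum.
Qed.

End RationalSpaces.

(** * The number of rational points *)

Theorem theorem1p2 (p e q : nat) (F : finFieldType) (K : closedFieldType)
    (iota : {rmorphism F -> K}) (k n j m : nat)
    (p_prime : prime p) (p_odd : odd p) (e_gt0 : (0 < e)%N)
    (q_def : q = (p ^ e)%N) (cardF : #|F| = q)
    (sqrtN1 : exists x : F, x ^+ 2 = - 1)
    (closK : is_algebraic_closure iota)
    (k_gt0 : (1 <= k)%N) (le_kn : (k <= n)%N) :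
  [/\ finite_set (Gr_points iota k n),
      [\/ (k, n) = (2 * j, 2 * m)%N,
          (k, n) = (2 * j, 2 * m + 1)%N |
          (k, n) = (2 * j + 1, 2 * m + 1)%N] ->
      let r : int := k%:Z * (n%:Z - k%:Z) - 2 * j%:Z * (m%:Z - j%:Z) in
      #|` fset_set (Gr_points iota k n)|%:R =
        q%:R ^ r * qbinom (q%:R ^+ 2) m j :> rat
    & (k, n) = (2 * j + 1, 2 * m)%N ->
      let r : int :=
        k%:Z * (n%:Z - k%:Z) - 2 * j%:Z * (m%:Z - j%:Z - 1) - m%:Z in
      #|` fset_set (Gr_points iota k n)|%:R =
        q%:R ^ r * qbinom (q%:R ^+ 2) (m - 1) j * (q%:R ^+ m - 1) :> rat].
Proof.
have two_neq0 : 2 != 0 :> F.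
  have p_char : p \in [pchar F] by apply: (@card_finPcharP F p e); rewrite ?cardF.
  rewrite -(dvdn_pcharf p_char); apply/negP => p2.
  have p_le2 := dvdn_leq (erefl : (0 < 2)%N) p2.
  have := prime_gt1 p_prime; have := p_odd.
  clear - p_le2; case: p p_le2 => [|[|[|]]] //.
have [iu iu2] := sqrtN1.
have [nu nu_nonsq sq_classes] := square_classes two_neq0.
case: k k_gt0 le_kn => // k' _; case: n => // n' kn.
have le_kn' : (k' <= n')%N by [].
have [fin ->] := card_Gr_points iota two_neq0 iu2 nu_nonsq sq_classes le_kn'.
have expz (r : int) l : r = l%:Z -> (q%:R : rat) ^ r = #|F|%:R ^+ l.
  by move=> ->; rewrite cardF -exprnP.
rewrite -cardF in expz *; split=> // [kn_eq r|[kE nE] r].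
  (* In each case [l] is half the dimension of the complement, rounded down; for
     [k] even, [k >= 1] gives [j = j'.+1]. *)
  case: kn_eq => -[kE nE].
  - have [j' jE] : exists j', j = j'.+1 by exists j.-1; lia.
    have [l mE] : exists l, m = (l + j)%N by exists (m - j)%N; lia.
    have k'E : k' = j'.*2.+1 by lia.
    have n'E : n' = (k' + l.*2)%N by lia.
    rewrite n'E k'E (card_nondeg_even_even two_neq0 iu2) // mE jE.
    by rewrite (expz _ (2 * l * j'.+1)%N) // /r; lia.
  - have [j' jE] : exists j', j = j'.+1 by exists j.-1; lia.
    have [l mE] : exists l, m = (l + j)%N by exists (m - j)%N; lia.
    have k'E : k' = j'.*2.+1 by lia.
    have n'E : n' = (k' + l.*2.+1)%N by lia.
    rewrite n'E k'E (card_nondeg_even_odd two_neq0 iu2) // mE jE.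
    by rewrite (expz _ (2 * l * j'.+1 + 2 * j'.+1)%N) // /r; lia.
  - have [l mE] : exists l, m = (l + j)%N by exists (m - j)%N; lia.
    have k'E : k' = j.*2 by lia.
    have n'E : n' = (k' + l.*2)%N by lia.
    rewrite n'E k'E (card_nondeg_odd_odd two_neq0 iu2) // mE.
    by rewrite (expz _ (2 * l * j + 2 * l)%N) // /r; lia.
have [l mE] : exists l, m = (l + j).+1 by exists (m - j.+1)%N; lia.
have k'E : k' = j.*2 by lia.
have n'E : n' = (k' + l.*2.+1)%N by lia.
rewrite n'E k'E (card_nondeg_odd_even two_neq0 iu2) // mE subn1.
by rewrite (expz _ (2 * l * j + l + j)%N) // /r; lia.
Qed.
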